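(* For all $\epsilon>0$, there exists a finite subset $A\subseteq\mathbb{Z}$ with $|A|>1$ such that $|A-A|\ge|A|^{2-\epsilon}$ but $|A+A|\le|A|^{1.7354+\epsilon}$.
   Context: $A+A=\{a+b:a,b\in A\}$ and $A-A=\{a-b:a,b\in A\}$. *)

(* Defs.v *)
From mathcomp Require Import all_boot all_order all_algebra finmap.

Set Implicit Arguments.
Unset Strict Implicit.
Unset Printing Implicit Defensive.

Definition sumset (A : {fset int}) : {fset int} :=
  [fset (a + b)%R | a in A, b in A]%fset.

Definition diffset (A : {fset int}) : {fset int} :=
  [fset (a - b)%R | a in A, b in A]%fset.

(* Main.v *)
Require Import Defs.
From mathcomp Require Import all_boot all_order all_algebra finmap.
From mathcomp Require Import reals exp.
From mathcomp Require Import sequences zify ring lra.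
Import Order.TTheory GRing.Theory Num.Theory.
Local Open Scope ring_scope.

(** The construction is random, after Ruzsa.  Let X and Y be independent
    letters drawn from one law on {0, ..., k}.  A word of n independent letters
    is read as the digits of an integer in base 2k+1; in that base, sums and
    differences of two such integers are the same thing as letterwise sums and
    differences of the words (see [code_cross]).

    - Differences.  By the law of large numbers ([nonneg_sums_likely]) two
      random words a, b have, with probability close to one, a difference a - b
      whose probability is about exp (- n H(X - Y)).  By the birthday principle ([sampling]),
      m words a_i and m words b_j with m about exp (n H(X - Y) / 2) then have
      about m^2 distinct differences a_i - b_j, as long as the words themselves
      do not repeat, that is, as long as H(X) > H(X - Y) / 2.  So the sampled
      set A, of size at most 2m, has a difference set of size of order |A|^2.

    - Sums.  The letters of a typical word add up to about n E[X], so the sum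
      of two typical words is a word over {0, ..., 2k} whose letters add up to
      about 2 n E[X].  However many words have been sampled, there are at most
      (z^(- 2 E[X]) (1 + z + ... + z^(2k)))^n such words, for every z in (0, 1]
      ([card_light]).

    Since n is arbitrarily large, the exponent reached for |A + A| is the
    limiting value of log |A + A| / log m,
      2 log (z^(- 2 E[X]) (1 + z + ... + z^(2k))) / H(X - Y)
    ([ruzsa_set] and [exponents_of_growth]).  It remains to exhibit a law for
    which this is at most 1.7354.  The probabilities 1674, 108, 9, 1 over 1792
    of the letters 0, 1, 2, 3, with z = 1/8, leave just enough room to replace
    all logarithms by rational multiples of ln 2, so that every numerical fact
    becomes rational arithmetic. *)

Set Implicit Arguments.
Unset Strict Implicit.
Unset Printing Implicit Defensive.

(** * Expectations over finite types and independent samples *)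

Section Mean.
Context {R : realType}.
Implicit Types T I : finType.

Definition mean T (p F : T -> R) : R := \sum_x p x * F x.

Definition is_dist T (p : T -> R) := (forall x, 0 <= p x) /\ \sum_x p x = 1.

(** The law of a family, indexed by [I], of independent draws from [p].  It is
    used at two levels: words are families of letters, and samples are families
    of words. *)
Definition iid I T (p : T -> R) (f : {ffun I -> T}) : R := \prod_i p (f i).

Lemma eq_mean T (p F G : T -> R) : F =1 G -> mean p F = mean p G.
Proof. by move=> FG; apply: eq_bigr => x _; rewrite FG. Qed.

Lemma le_mean T (p F G : T -> R) : is_dist p ->
  (forall x, F x <= G x) -> mean p F <= mean p G.
Proof. by move=> [p0 _] FG; apply: ler_sum => x _; apply: ler_wpM2l. Qed.

Lemma mean_cst T (p : T -> R) c : is_dist p -> mean p (fun=> c) = c.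
Proof. by move=> [_ p1]; rewrite /mean -mulr_suml p1 mul1r. Qed.

Lemma mean_ge0 T (p F : T -> R) : is_dist p ->
  (forall x, 0 <= F x) -> 0 <= mean p F.
Proof. by move=> dp F0; rewrite -(mean_cst 0 dp); apply: le_mean. Qed.

Lemma meanD T (p F G : T -> R) :
  mean p (fun x => F x + G x) = mean p F + mean p G.
Proof. by rewrite /mean -big_split; apply: eq_bigr => x _; rewrite mulrDr. Qed.

Lemma meanZl T (p F : T -> R) c : mean p (fun x => c * F x) = c * mean p F.
Proof. by rewrite /mean mulr_sumr; apply: eq_bigr => x _; rewrite mulrCA. Qed.

Lemma meanN T (p F : T -> R) : mean p (fun x => - F x) = - mean p F.
Proof. by rewrite /mean -sumrN; apply: eq_bigr => x _; rewrite mulrN. Qed.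

Lemma mean_sum T J (r : seq J) (p : T -> R) (F : J -> T -> R) :
  mean p (fun x => \sum_(j <- r) F j x) = \sum_(j <- r) mean p (F j).
Proof.
by rewrite exchange_big; apply: eq_bigr => x _; rewrite mulr_sumr.
Qed.

Lemma mean_exchange T (U : finType) (p : T -> R) (q : U -> R) (F : T -> U -> R) :
  mean p (fun x => mean q (F x)) = mean q (fun y => mean p (F^~ y)).
Proof.
rewrite (mean_sum _ p (fun y x => q y * F x y)).
by apply: eq_bigr => y _; rewrite meanZl.
Qed.

(** The probabilistic method; it extracts the sample from its expected score. *)
Lemma mean_exists T (p F : T -> R) c : is_dist p ->
  c <= mean p F -> exists x, c <= F x.
Proof.
move=> dp; case: (pickP (@predT T)) => [x0 _|T0]; last first.
  by case: dp => _; rewrite big_pred0 // => /esym/eqP; rewrite oner_eq0.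
case: (arg_maxP F (erefl (predT x0))) => x _ xmax cF; exists x.
by rewrite (le_trans cF) // -(mean_cst (F x) dp) le_mean // => y; apply: xmax.
Qed.

(** Independence.  Everything below about [iid] is deduced from this identity,
    which is the distributivity of the product over the sum. *)
Lemma mean_iid_prod I T (p : T -> R) (F : I -> T -> R) :
  mean (iid p) (fun f : {ffun I -> T} => \prod_i F i (f i))
  = \prod_i mean p (F i).
Proof.
rewrite /mean bigA_distr_bigA; apply: eq_bigr => f _.
by rewrite /iid -big_split.
Qed.

Lemma iid_dist I T (p : T -> R) : is_dist p -> is_dist (@iid I T p).
Proof.
move=> [p0 p1]; split=> [f|]; first exact: prodr_ge0.
have /= := mean_iid_prod p (fun (_ : I) (_ : T) => 1).
rewrite [RHS]big1 => [<-|i _]; last exact: mean_cst.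
by apply: eq_bigr => f _; rewrite big1_eq mulr1.
Qed.

Lemma mean_dirac T (p F : T -> R) y :
  mean p (fun x => (x == y)%:R * F x) = p y * F y.
Proof.
rewrite /mean (bigD1 y) //= eqxx mul1r big1 ?addr0 // => x /negbTE ->.
by rewrite mul0r mulr0.
Qed.

Lemma mean_iid_coord I T (p : T -> R) (F : T -> R) (i : I) : is_dist p ->
  mean (iid p) (fun f : {ffun I -> T} => F (f i)) = mean p F.
Proof.
move=> dp; pose H k x := if k == i then F x else 1.
transitivity (mean (iid p) (fun f : {ffun I -> T} => \prod_k H k (f k))).
  apply: eq_mean => f; rewrite (bigD1 i) //= /H eqxx big1 ?mulr1 // => k.
  by move=> /negbTE ->.
rewrite mean_iid_prod (bigD1 i) //= /H eqxx big1 ?mulr1 // => k /negbTE ->.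
exact: mean_cst.
Qed.

(** Distinct coordinates are independent: decompose [F (f i) (f j)] along the
    value [x] of [f i], which makes it a sum of products over coordinates. *)
Lemma mean_iid_coord2 I T (p : T -> R) (F : T -> T -> R) (i j : I) :
  is_dist p -> i != j ->
  mean (iid p) (fun f : {ffun I -> T} => F (f i) (f j))
  = mean p (fun x => mean p (F x)).
Proof.
move=> dp ij; have ji : (j == i) = false by rewrite eq_sym (negbTE ij).
pose H x k y := if k == i then (y == x)%:R else if k == j then F x y else 1.
transitivity (mean (iid p)
   (fun f : {ffun I -> T} => \sum_x \prod_k H x k (f k))).
  apply: eq_mean => f; rewrite (bigD1 (f i)) //= (bigD1 i) //= (bigD1 j) ?ji //=.
  rewrite /H eqxx ji !eqxx mul1r big1 ?mulr1 => [|k /andP[/negbTE -> /negbTE ->]] //.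
  rewrite big1 ?addr0 // => x xi.
  by rewrite (bigD1 i) //= eqxx eq_sym (negbTE xi) mul0r.
rewrite mean_sum; apply: eq_bigr => x _.
rewrite mean_iid_prod (bigD1 i) //= (bigD1 j) ?ji //= /H eqxx ji eqxx.
rewrite big1 ?mulr1 => [|k /andP[/negbTE -> /negbTE ->]]; last exact: mean_cst.
congr (_ * _); have := mean_dirac p (fun=> 1) x; rewrite mulr1 => <-.
by apply: eq_mean => y; rewrite mulr1.
Qed.

End Mean.

(** * A birthday argument for differences *)

Section Sampling.
Context {R : realType}.

(** A lower bound for the number of values of [d] that is linear in
    indicators of pairs, so that it can be averaged: keep the indices whose
    value is taken nowhere else.  Each kept index contributes one to the sum and
    every other index contributes at most zero. *)
Lemma uniquely_represented (I : finType) (D : eqType) (good : pred I)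
    (d : I -> D) :
  exists Y : {set I}, [/\ {in Y, forall i, good i}, {in Y &, injective d}
    & \sum_i (good i)%:R * (2 - \sum_j (d j == d i)%:R) <= #|Y|%:R :> R].
Proof.
pose uniq i := [forall j, (d j == d i) ==> (j == i)].
exists [set i | good i && uniq i]; split=> [i|i j|].
- by rewrite inE => /andP[].
- rewrite !inE => _ /andP[_ /forallP uj] dij.
  by apply/eqP; apply: (implyP (uj i)); rewrite dij.
rewrite -sum1_card natr_sum [leRHS]big_mkcond /=; apply: ler_sum => i _.
rewrite inE; case: (good i) => /=; last by rewrite mul0r.
rewrite mul1r; have pos (P : pred I) : 0 <= \sum_(j | P j) (d j == d i)%:R :> R.
  by apply: sumr_ge0 => j _.
case: ifP => [_|/negbT]; first by rewrite (bigD1 i) //= eqxx; have /= := pos (fun j => j != i); lra.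
rewrite negb_forall => /existsP[j]; rewrite negb_imply => /andP[dj ji].
rewrite (bigD1 i) //= (bigD1 j) //= eqxx dj /=.
by have /= := pos (fun k => (k != i) && (k != j)); lra.
Qed.

Variables (T : finType) (D : eqType) (p : T -> R) (d : T -> T -> D).
Variables (good : rel T) (rho : R) (m : nat).
Hypothesis dp : is_dist p.
Hypothesis rho_ge0 : 0 <= rho.
Hypothesis m_rho : 8 * m%:R * rho <= 1.

Hypothesis diff_rare : forall a b, good a b ->
  mean p (fun a' => mean p (fun b' => (d a' b' == d a b)%:R)) <= rho ^+ 2.
Hypothesis left_rare : forall a b, good a b ->
  mean p (fun a' => (d a' b == d a b)%:R) <= rho.
Hypothesis right_rare : forall a b, good a b ->
  mean p (fun b' => (d a b' == d a b)%:R) <= rho.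

Let gamma : R := mean p (fun a => mean p (fun b => (good a b)%:R)).
(* Moving from one sampled index to a different one costs a factor rho. *)
Let cost (i j : 'I_m) : R := if i == j then 1 else rho.
Let K a a' b b' : R := (good a b)%:R * (d a' b' == d a b)%:R.

(** Two pairs of sampled words may share the left word, the right word, both or
    none.  Each case averages over different independent words, and each of the
    three rarity hypotheses covers one of the cases with distinct pairs. *)
Lemma collision_mean (i i' j j' : 'I_m) :
  mean (iid p) (fun u : {ffun 'I_m -> T} =>
    mean (iid p) (fun v : {ffun 'I_m -> T} => K (u i) (u i') (v j) (v j')))
  <= gamma * (cost i i' * cost j j').
Proof.
have goodM a b (x c : R) : (good a b -> x <= c) ->
    (good a b)%:R * x <= c * (good a b)%:R.
  by case: (good a b) => [/(_ isT)|_]; rewrite ?mul1r ?mulr1 // mul0r mulr0.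
have meanM c : gamma * c =
    mean p (fun a => mean p (fun b => c * (good a b)%:R)).
  by rewrite mulrC -meanZl; apply: eq_mean => a; rewrite meanZl.
rewrite meanM /cost; have [<-|ii'] := eqVneq i i'; have [<-|jj'] := eqVneq j j'.
- rewrite (eq_mean _ (G := fun u : {ffun 'I_m -> T} =>
      mean p (fun b => K (u i) (u i) b b))) => [|u]; last first.
    by rewrite (mean_iid_coord (fun b => K (u i) (u i) b b)).
  rewrite (mean_iid_coord (fun a => mean p (fun b => K a a b b))) //.
  by do 2![apply: le_mean => // ?]; apply: goodM; rewrite eqxx mulr1.
- rewrite (eq_mean _ (G := fun u : {ffun 'I_m -> T} =>
      mean p (fun b => mean p (K (u i) (u i) b)))) => [|u]; last first.
    by rewrite (mean_iid_coord2 (fun b b' => K (u i) (u i) b b')).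
  rewrite (mean_iid_coord (fun a => mean p (fun b => mean p (K a a b)))) //.
  do 2![apply: le_mean => // ?]; rewrite meanZl; apply: goodM.
  by rewrite mul1r; apply: right_rare.
- rewrite (eq_mean _ (G := fun u : {ffun 'I_m -> T} =>
      mean p (fun b => K (u i) (u i') b b))) => [|u]; last first.
    by rewrite (mean_iid_coord (fun b => K (u i) (u i') b b)).
  rewrite (mean_iid_coord2 (fun a a' => mean p (fun b => K a a' b b))) //.
  apply: le_mean => // a; rewrite mean_exchange; apply: le_mean => // b.
  by rewrite meanZl; apply: goodM; rewrite mulr1; apply: left_rare.
- rewrite (eq_mean _ (G := fun u : {ffun 'I_m -> T} =>
      mean p (fun b => mean p (K (u i) (u i') b)))) => [|u]; last first.
    by rewrite (mean_iid_coord2 (fun b b' => K (u i) (u i') b b')).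
  rewrite (mean_iid_coord2 (fun a a' => mean p (fun b => mean p (K a a' b)))) //.
  apply: le_mean => // a; rewrite mean_exchange; apply: le_mean => // b.
  rewrite (eq_mean _ (G := fun a' => (good a b)%:R *
      mean p (fun b' => (d a' b' == d a b)%:R))) => [|a']; last exact: meanZl.
  by rewrite meanZl; apply: goodM; rewrite -expr2; apply: diff_rare.
Qed.

(** The square of 9/8 is at most 3/2, so a good pair coincides on average with
    at most half a pair other than itself. *)
Lemma sum_cost i : \sum_j cost i j <= 9 / 8.
Proof.
rewrite (bigD1 i) //= /cost eqxx.
apply: (@le_trans _ _ (1 + \sum_(j < m) rho)).
  rewrite lerD2l big_mkcond /=; apply: ler_sum => j _.
  by rewrite eq_sym; case: (i == j).
by rewrite sumr_const card_ord -[rho *+ m]mulr_natl; have := m_rho; lra.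
Qed.

(** A sample of [m] left and [m] right elements realizes a positive proportion
    of the [m ^ 2] conceivable values of [d], up to the probability of being
    good, when coincidences are rare at the scale [1 / m]. *)
Lemma sampling : exists (u v : {ffun 'I_m -> T}) (Y : {set 'I_m * 'I_m}),
  [/\ {in Y, forall ij, good (u ij.1) (v ij.2)},
      {in Y &, injective (fun ij => d (u ij.1) (v ij.2))}
    & m%:R ^+ 2 * gamma / 2 <= #|Y|%:R].
Proof.
have diid := @iid_dist R 'I_m T p dp.
pose score (u v : {ffun 'I_m -> T}) : R := \sum_(ij : 'I_m * 'I_m)
  (good (u ij.1) (v ij.2))%:R
  * (2 - \sum_kl (d (u kl.1) (v kl.2) == d (u ij.1) (v ij.2))%:R).
have gamma_ge0 : 0 <= gamma by do 2![apply: mean_ge0 => // ?]; rewrite ler0n.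
suff : m%:R ^+ 2 * gamma / 2 <= mean (iid p) (fun u => mean (iid p) (score u)).
  move=> /(mean_exists diid)[u /(mean_exists diid)[v le_score]].
  have [Y [goodY injY leY]] := uniquely_represented
    (fun ij : 'I_m * 'I_m => good (u ij.1) (v ij.2))
    (fun ij => d (u ij.1) (v ij.2)).
  by exists u, v, Y; split=> //; apply: le_trans leY.
have -> : mean (iid p) (fun u => mean (iid p) (score u)) =
  \sum_(ij : 'I_m * 'I_m) (2 * gamma - \sum_(kl : 'I_m * 'I_m)
     mean (iid p) (fun u : {ffun 'I_m -> T} => mean (iid p)
       (fun v : {ffun 'I_m -> T} => K (u ij.1) (u kl.1) (v ij.2) (v kl.2)))).
  under eq_mean do rewrite mean_sum.
  rewrite mean_sum; apply: eq_bigr => -[i j] _ /=.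
  under eq_mean => u.
    under eq_mean => v do rewrite mulrBr mulr_sumr mulrC -mulN1r.
    rewrite meanD meanZl meanZl mean_sum.
    rewrite (mean_iid_coord (fun b => (good (u i) b)%:R)) //.
    over.
  rewrite meanD !meanZl mean_sum mulN1r.
  by rewrite (mean_iid_coord (fun a => mean p (fun b => (good a b)%:R))).
apply: (@le_trans _ _ (\sum_(ij : 'I_m * 'I_m) gamma / 2)).
  rewrite sumr_const card_prod card_ord -[_ *+ (m * m)]mulr_natl natrM; lra.
apply: ler_sum => -[i j] _ /=.
suff : \sum_(kl : 'I_m * 'I_m) gamma * (cost i kl.1 * cost j kl.2)
    <= gamma * (3 / 2).
  have : \sum_(kl : 'I_m * 'I_m) _ <= \sum_(kl : 'I_m * 'I_m) _ :=
    ler_sum _ (fun kl _ => collision_mean i kl.1 j kl.2).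
  by move=> /= le1 le2; have := le_trans le1 le2; lra.
rewrite -mulr_sumr ler_wpM2l //.
rewrite -(pair_bigA _ (fun k l => cost i k * cost j l)) /=.
under eq_bigr do rewrite -mulr_sumr.
rewrite -mulr_suml; apply: (@le_trans _ _ ((9 / 8) * (9 / 8))); last lra.
have cost_ge0 k : 0 <= \sum_j cost k j.
  by apply: sumr_ge0 => l _; rewrite /cost; case: ifP.
by apply: ler_pM => //; apply: sum_cost.
Qed.

End Sampling.

(** * Large deviations *)

Section LargeDeviations.
Context {R : realType}.
Variables (T : finType) (p : T -> R).
Hypothesis dp : is_dist p.

Lemma mean2_iid_prod (I : finType) (F : I -> T -> T -> R) :
  mean (iid p) (fun a : {ffun I -> T} => mean (iid p)
    (fun b : {ffun I -> T} => \prod_i F i (a i) (b i)))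
  = \prod_i mean p (fun x => mean p (F i x)).
Proof.
rewrite -(mean_iid_prod p (fun i x => mean p (F i x))).
by apply: eq_mean => a; rewrite (mean_iid_prod p (fun i => F i (a i))).
Qed.

(** A quadratic upper bound for the exponential near zero, from
    [exp (- x) <= 1 / (1 + x)]. *)
Lemma expRN_le (x : R) : `|x| <= 1 / 2 -> expR (- x) <= 1 - x + 2 * x ^+ 2.
Proof.
rewrite ler_norml => /andP[x1 x2].
have y0 : 0 < 1 + x by lra.
rewrite expRN; apply: (@le_trans _ _ (1 + x)^-1).
  by rewrite lef_pV2 ?posrE ?expR_gt0 ?expR_ge1Dx.
rewrite -[X in X <= _]mul1r ler_pdivrMr //.
have : 0 <= x ^+ 2 * (1 + 2 * x) by rewrite mulr_ge0 ?sqr_ge0 //; lra.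
lra.
Qed.

(** A variable with positive mean has an exponential moment less than one:
    to first order in [t], the moment is one minus [t] times the mean. *)
Lemma mgf_lt1 (f : T -> T -> R) : 0 < mean p (fun x => mean p (f x)) ->
  exists t c : R, [/\ 0 < t, 0 < c &
    mean p (fun x => mean p (fun y => expR (- (t * f x y)))) <= expR (- c)].
Proof.
set mu := mean _ _ => mu_gt0.
pose M : R := 1 + \sum_x \sum_y `|f x y|.
have fM x y : `|f x y| <= M.
  rewrite /M (bigD1 x) //= (bigD1 y) //=.
  have : 0 <= \sum_(z | z != y) `|f x z| by apply: sumr_ge0.
  have : 0 <= \sum_(z | z != x) \sum_u `|f z u|.
    by do 2![apply: sumr_ge0 => ? _].
  by set A := \sum_(_ | _) _; set B := \sum_(_ | _) _; lra.
have M_gt0 : 0 < M.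
  have : 0 <= \sum_x \sum_y `|f x y| by do 2![apply: sumr_ge0 => ? _].
  by rewrite /M; lra.
have muM : mu <= M.
  rewrite -(mean_cst M dp) le_mean // => x.
  rewrite -(mean_cst M dp) le_mean // => y.
  exact: le_trans (ler_norm _) (fM x y).
(* This value minimizes the bound 1 - t mu + 2 t^2 M^2 for the moment. *)
pose t := mu / (4 * M ^+ 2).
have t_gt0 : 0 < t by rewrite divr_gt0 // mulr_gt0 // exprn_gt0.
have tM : t * M ^+ 2 = mu / 4.
  by rewrite /t; field; rewrite gt_eqF.
have tM2 : t * M <= 1 / 2.
  rewrite -(ler_pM2r M_gt0) -mulrA -expr2 tM; lra.
exists t, (t * mu / 2); split=> //; first by rewrite divr_gt0 // mulr_gt0.
apply: (@le_trans _ _ (1 - t * mu / 2)); last first.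
  by have := expR_ge1Dx (- (t * mu / 2)).
have -> : 1 - t * mu / 2 = mean p (fun x => mean p
    (fun y => 1 + (- t * f x y + 2 * t ^+ 2 * M ^+ 2))).
  under eq_mean do rewrite meanD mean_cst // meanD mean_cst // meanZl.
  rewrite meanD mean_cst // meanD mean_cst // meanZl -/mu.
  have -> : 2 * t ^+ 2 * M ^+ 2 = 2 * t * (t * M ^+ 2) by ring.
  by rewrite tM; field.
do 2![apply: le_mean => // ?]; set fxy := f _ _.
have tf : `|t * fxy| <= t * M by rewrite normrM gtr0_norm // ler_pM2l // fM.
apply: le_trans (expRN_le (le_trans tf tM2)) _.
have : (t * fxy) ^+ 2 <= (t * M) ^+ 2.
  rewrite -[leLHS]real_normK ?num_real // lerXn2r ?nnegrE //.
  exact: le_trans (normr_ge0 _) tf.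
by rewrite !exprMn; lra.
Qed.

(** Chernoff's bound: the indicator of a negative sum is at most
    [expR (- t * sum)], whose mean is the [n]-th power of the exponential
    moment. *)
Lemma negative_sum_rare (f : T -> T -> R) (e : R) :
  0 < mean p (fun x => mean p (f x)) -> 0 < e ->
  exists n0, forall n, (n0 <= n)%N ->
    mean (iid p) (fun a : {ffun 'I_n -> T} => mean (iid p)
      (fun b : {ffun 'I_n -> T} => (\sum_i f (a i) (b i) < 0)%R%:R)) <= e.
Proof.
move=> /mgf_lt1[t [c [t_gt0 c_gt0 mgf]]] e_gt0.
exists (Num.truncn ((e * c)^-1)).+1 => n n0n.
apply: (@le_trans _ _ (expR (- c) ^+ n)); last first.
  rewrite -expRM_natl mulrN expRN -[leRHS]invrK lef_pV2 ?posrE ?invr_gt0 ?expR_gt0 //.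
  have : e^-1 <= n%:R * c.
    rewrite -ler_pdivrMr // -invfM ltW // (lt_le_trans (truncnS_gt _)) //.
    by rewrite ler_nat.
  have := expR_ge1Dx (n%:R * c); lra.
apply: (@le_trans _ _ (\prod_(i < n) mean p (fun x => mean p
    (fun y => expR (- (t * f x y)))))); last first.
  rewrite -[X in _ <= _ ^+ X]card_ord -prodr_const.
  apply: ler_prod => i _; rewrite mgf andbT.
  by do 2![apply: mean_ge0 => // ?]; apply: expR_ge0.
rewrite -mean2_iid_prod.
have diid := @iid_dist R 'I_n T p dp.
do 2![apply: le_mean => // ?]; rewrite -expR_sum sumrN -mulr_sumr.
case: ltP => [sum_lt0|_] /=; last exact: expR_ge0.
by rewrite -expR0 ler_expR oppr_ge0 pmulr_rle0 // ltW.
Qed.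

End LargeDeviations.

(** * Integers coded by words *)

Lemma digits_inj b n (x y : 'I_n -> nat) :
  (forall i, x i < b)%N -> (forall i, y i < b)%N ->
  (\sum_i x i * b ^ i = \sum_i y i * b ^ i)%N -> x =1 y.
Proof.
elim: n x y => [|n IHn] x y xb yb; first by move=> _ [].
rewrite !big_ord_recl /= !expn0 !muln1.
have shift (z : 'I_n.+1 -> nat) : (\sum_(i < n) z (lift ord0 i) * b ^ bump 0 i
    = (\sum_(i < n) z (lift ord0 i) * b ^ i) * b)%N.
  by rewrite big_distrl /=; apply: eq_bigr => i _; rewrite -mulnA -expnSr.
rewrite !shift !(addnC (_ ord0)) => eqxy.
have b_gt0 : (0 < b)%N := leq_ltn_trans (leq0n _) (xb ord0).
have eq0 : x ord0 = y ord0.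
  by have := congr1 (modn^~ b) eqxy; rewrite !modnMDl !modn_small.
have := congr1 (divn^~ b) eqxy; rewrite !divnMDl // !divn_small // !addn0.
move=> /(IHn (fun i => x (lift ord0 i)) (fun i => y (lift ord0 i))) eqS i.
case: (unliftP ord0 i) => [j ->|->//]; exact: eqS.
Qed.

Lemma card_fset_le (s : seq int) (B : {fset int}) :
  {subset B <= s} -> (#|` B| <= size s)%N.
Proof. by move=> Bs; apply: uniq_leq_size. Qed.

Lemma card_diffset (A : {fset int}) : (#|` diffset A| <= #|` A| ^ 2)%N.
Proof.
rewrite expnS expn1 -(size_allpairs (fun a b => a - b)); apply: card_fset_le => x.
by move=> /imfset2P[/= a aA [b bA ->]]; apply/allpairsP; exists (a, b).
Qed.

Section Ruzsa.
Context {R : realType}.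
Variable k : nat.
Local Notation letter := 'I_k.+1.
Local Notation base := k.*2.+1.
Local Notation word n := {ffun 'I_n -> letter}.

(** The base is tied to [k], not to the alphabet ['I_b], because the words over
    {0, ..., 2k} that arise as sums are coded in the same base. *)
Definition code b n (w : {ffun 'I_n -> 'I_b}) : nat := \sum_i w i * base ^ i.

Definition light b n (c : R) (w : {ffun 'I_n -> 'I_b}) : bool :=
  \sum_i (w i)%:R <= c * n%:R.

(** The base [2k+1] exceeds the sum of two letters, so no carries occur and the
    difference of two codes determines the letterwise differences.  They are
    stated as crosswise sums, which stay in [nat]. *)
Lemma code_cross n (a b a' b' : word n) :
  (code a')%:Z - (code b')%:Z = (code a)%:Z - (code b)%:Z ->
  forall i, (a' i + b i = a i + b' i)%N.
Proof.
move=> eq_diff.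
have eq_sum : (code a' + code b = code a + code b')%N by lia.
apply: (@digits_inj base) => [i|i|].
- by have := ltn_ord (a' i); have := ltn_ord (b i); lia.
- by have := ltn_ord (a i); have := ltn_ord (b' i); lia.
move: eq_sum; rewrite /code -!big_split /= => eq_sum.
by under eq_bigr do rewrite mulnDl; rewrite eq_sum; apply: eq_bigr => i _; rewrite mulnDl.
Qed.

(** Markov's inequality for counting: a word whose letters average at most [c]
    has weight at least one for the product weight [expR (tau * (c - letter))],
    and the total weight is an [n]-th power. *)
Lemma card_light b n (c tau s : R) : 0 <= tau ->
  \sum_(j < b) expR (tau * (c - j%:R)) <= expR s ->
  #|[pred w : {ffun 'I_n -> 'I_b} | light c w]|%:R <= expR (s * n%:R).
Proof.
move=> tau_ge0 le_s; rewrite -sum1_card natr_sum big_mkcond /=.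
apply: (@le_trans _ _ (\prod_(i < n) \sum_(j < b) expR (tau * (c - j%:R)))).
  rewrite bigA_distr_bigA; apply: ler_sum => w _.
  rewrite -expR_sum -mulr_sumr sumrB sumr_const card_ord inE /light.
  case: ifP => [light_w|_]; last exact: expR_ge0.
  by rewrite -[leLHS]expR0 ler_expR mulr_ge0 // subr_ge0 -[c *+ n]mulr_natr.
rewrite expRM_natr -[X in _ <= _ ^+ X]card_ord -prodr_const.
by apply: ler_prod => i _; rewrite le_s sumr_ge0 // => j _; apply: expR_ge0.
Qed.

(** The bound does not involve the size of [A]: the sums are codes of light words
    over a larger alphabet. *)
Lemma sumset_light n (c tau s : R) (A : {fset int}) :
  0 <= tau -> \sum_(j < base) expR (tau * (2 * c - j%:R)) <= expR s ->
  (forall x, x \in A -> exists2 w : word n, light c w & x = (code w)%:Z) ->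
  #|` sumset A|%:R <= expR (s * n%:R).
Proof.
move=> tau_ge0 le_s Alight; apply: le_trans (card_light n tau_ge0 le_s).
rewrite ler_nat cardE -(size_map (fun w => (code w)%:Z)).
apply: card_fset_le => x /imfset2P[/= a /Alight[w lw ->] [b /Alight[w' lw' ->] ->]].
pose ww : {ffun 'I_n -> 'I_base} := [ffun i => inord (w i + w' i)].
have wwE i : ww i = (w i + w' i)%N :> nat.
  by rewrite ffunE inordK //; have := ltn_ord (w i); have := ltn_ord (w' i); lia.
apply/mapP; exists ww.
  rewrite mem_enum inE /light; under eq_bigr do rewrite wwE natrD.
  by rewrite big_split /=; move: lw lw'; rewrite /light; lra.
rewrite -PoszD; congr Posz; rewrite /code -big_split /=.
by apply: eq_bigr => i _; rewrite wwE mulnDl.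
Qed.

(** * The random set *)

Variables (p : letter -> R) (dp : is_dist p).

(** The weak law of large numbers in the form needed here: finitely many
    letterwise statistics with positive mean have nonnegative sums
    simultaneously, by Chernoff's bound and a union bound. *)
Lemma nonneg_sums_likely (J : finType) (f : J -> letter -> letter -> R) :
  (forall j, 0 < mean p (fun x => mean p (f j x))) ->
  exists n0, forall n, (n0 <= n)%N -> 1 / 2 <=
    mean (iid p) (fun a : word n => mean (iid p) (fun b : word n =>
      [forall j, 0 <= \sum_i f j (a i) (b i)]%R%:R)).
Proof.
move=> f_gt0; pose e : R := (2 * (#|J|.+1)%:R)^-1.
have e_gt0 : 0 < e by rewrite invr_gt0 mulr_gt0 // ltr0n.
have /fin_all_exists[n0 rare] : forall j, exists n0, forall n, (n0 <= n)%N -> _ :=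
  fun j => negative_sum_rare dp (f_gt0 j) e_gt0.
exists (\max_j n0 j)%N => n n0n.
have diid := @iid_dist R 'I_n letter p dp.
pose bad j (a b : word n) : R := (\sum_i f j (a i) (b i) < 0)%R%:R.
apply: (@le_trans _ _ (1 + - 1 * \sum_j
    mean (iid p) (fun a => mean (iid p) (bad j a)))).
  have : \sum_j mean (iid p) (fun a => mean (iid p) (bad j a)) <= \sum_(j : J) e.
    by apply: ler_sum => j _; apply: rare; apply: leq_trans n0n; apply: leq_bigmax.
  rewrite sumr_const -[e *+ _]mulr_natr => sum_le.
  have : e * #|J|%:R <= 1 / 2.
    by rewrite /e mulrC ler_pdivrMr ?mulr_gt0 ?ltr0n // -[#|J|.+1%:R]natr1; lra.
  lra.
rewrite -mean_sum -meanZl -[X in X + _](mean_cst _ diid) -meanD.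
apply: le_mean => // a.
rewrite -mean_sum -meanZl -[X in X + _](mean_cst _ diid) -meanD.
apply: le_mean => // b.
have bad_ge0 (P : pred J) : 0 <= \sum_(j | P j) bad j a b.
  by apply: sumr_ge0 => j _; rewrite ler0n.
case: forallP => [_|/forallP] /=; first by have /= := bad_ge0 predT; lra.
rewrite negb_forall => /existsP[j]; rewrite -ltNge => badj.
rewrite (bigD1 j) //= {1}/bad badj /=.
by have /= := bad_ge0 (fun i => i != j); lra.
Qed.

(** Here [l x] and [g x y] stand for the information contents
    [- ln P(X = x)] and [- ln P(X - Y = x - y)]; lower bounds for them suffice.
    With the exact values, [mean_l] and [mean_g] say that [alpha] is less than
    H(X) and H(X - Y) / 2.  The real [tau] is [- ln z] for the parameter z of
    the count of sums. *)
Variables (kappa alpha sigma tau : R).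
Variables (l : letter -> R) (g : letter -> letter -> R).
Hypothesis mean_kappa : mean p (fun x => x%:R) < kappa.
Hypothesis mean_l : alpha < mean p l.
Hypothesis mean_g : 2 * alpha < mean p (fun x => mean p (g x)).
Hypothesis p_le : forall x, p x <= expR (- l x).
Hypothesis diff_le : forall x y : letter, mean p (fun x' : letter => mean p
  (fun y' : letter => (x' + y == x + y')%N%:R)) <= expR (- g x y).
Hypothesis tau_ge0 : 0 <= tau.
Hypothesis sum_le :
  \sum_(j < base) expR (tau * (2 * kappa - j%:R)) <= expR sigma.

(** One indexed family, so that the law of large numbers applies to all the
    requirements on a pair of words at once: both words are light, neither is
    too likely, and their difference is not too likely. *)
Definition excess (j : 'I_5) : letter -> letter -> R :=
  nth (fun _ _ => 0)
    [:: fun x _ : letter => kappa - x%:R; fun _ y : letter => kappa - y%:R;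
        fun x _ => l x - alpha; fun _ y => l y - alpha;
        fun x y => g x y - 2 * alpha] j.

Definition typical n (a b : word n) : bool :=
  [forall j, 0 <= \sum_i excess j (a i) (b i)].

Lemma typicalP n (a b : word n) : typical a b ->
  [/\ light kappa a, light kappa b,
      alpha * n%:R <= \sum_i l (a i), alpha * n%:R <= \sum_i l (b i)
    & 2 * alpha * n%:R <= \sum_i g (a i) (b i)].
Proof.
have E (F : 'I_n -> R) c : \sum_i (F i - c) = \sum_i F i - c * n%:R.
  by rewrite sumrB sumr_const card_ord mulr_natr.
have E' (F : 'I_n -> R) c : \sum_i (c - F i) = c * n%:R - \sum_i F i.
  by rewrite sumrB sumr_const card_ord mulr_natr.
move=> /forallP typ; rewrite /light.
have /= := typ (@Ordinal 5 0 isT); have /= := typ (@Ordinal 5 1 isT).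
have /= := typ (@Ordinal 5 2 isT); have /= := typ (@Ordinal 5 3 isT).
have /= := typ (@Ordinal 5 4 isT).
by rewrite !E !E' !subr_ge0; split.
Qed.

Lemma typical_likely : exists n0, forall n, (n0 <= n)%N -> 1 / 2 <=
  mean (iid p) (fun a : word n => mean (iid p) (fun b => (typical a b)%:R)).
Proof.
apply: (nonneg_sums_likely (f := excess)) => -[[|[|[|[|[|//]]]]] ?]; rewrite /excess /=.
- under eq_mean do rewrite mean_cst //.
  by rewrite meanD mean_cst // meanN subr_gt0.
- by rewrite mean_cst // meanD mean_cst // meanN subr_gt0.
- under eq_mean do rewrite mean_cst //.
  by rewrite meanD mean_cst // subr_gt0.
- by rewrite mean_cst // meanD mean_cst // subr_gt0.
- under eq_mean do rewrite meanD mean_cst //.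
  by rewrite meanD mean_cst // subr_gt0.
Qed.

(** The scale of rarity: about [1 / rho n] words will be sampled. *)
Definition rho n : R := expR (- (alpha * n%:R)).

Lemma word_rare n (a : word n) :
  alpha * n%:R <= \sum_i l (a i) -> iid p a <= rho n.
Proof.
move=> heavy; apply: (@le_trans _ _ (\prod_i expR (- l (a i)))).
  by apply: ler_prod => i _; rewrite p_le dp.1.
by rewrite -expR_sum sumrN ler_expR lerN2.
Qed.

(** Letterwise differences are independent, so the probability of a given
    difference of words is the product of the probabilities of its letters. *)
Lemma diff_rare n (a b : word n) :
  2 * alpha * n%:R <= \sum_i g (a i) (b i) ->
  mean (iid p) (fun a' : word n => mean (iid p) (fun b' : word n =>
    ((code a')%:Z - (code b')%:Z == (code a)%:Z - (code b)%:Z)%:R))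
  <= rho n ^+ 2.
Proof.
move=> spread; have diid := @iid_dist R 'I_n letter p dp.
apply: (@le_trans _ _ (\prod_i expR (- g (a i) (b i)))); last first.
  rewrite -expR_sum sumrN /rho -expRM_natl ler_expR; lra.
apply: (@le_trans _ _ (\prod_(i < n) mean p (fun x' : letter => mean p
    (fun y' : letter => (x' + b i == a i + y')%N%:R)))); last first.
  apply: ler_prod => i _; rewrite diff_le andbT.
  by do 2![apply: mean_ge0 => // ?]; rewrite ler0n.
rewrite -mean2_iid_prod.
apply: le_mean => // a'; apply: le_mean => // b'.
have [/code_cross cross|_] /= := eqVneq; last by rewrite prodr_ge0.
by rewrite big1 // => i _; rewrite cross eqxx.
Qed.

(** The set consists of the light words among the sampled ones.  Typical pairs
    are light, so discarding the other words does not affect the distinct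
    differences provided by [sampling], whereas it makes the count of sums
    valid for all of [A]. *)
Lemma ruzsa_set : exists n0, forall n, (n0 <= n)%N ->
  exists A : {fset int}, [/\
    (#|` A| <= 2 * Num.truncn (expR (alpha * n%:R) / 8))%N,
    (Num.truncn (expR (alpha * n%:R) / 8) ^ 2 <= 4 * #|` diffset A|)%N
    & #|` sumset A|%:R <= expR (sigma * n%:R)].
Proof.
have [n0 likely] := typical_likely; exists n0 => n /likely half.
set m := Num.truncn _; have diid := @iid_dist R 'I_n letter p dp.
pose d (a b : word n) := (code a)%:Z - (code b)%:Z.
have m_rho : 8 * m%:R * rho n <= 1.
  rewrite /rho expRN ler_pdivrMr ?expR_gt0 // mul1r mulrC -ler_pdivlMr //.
  by rewrite /m truncn_le divr_ge0 // expR_ge0.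
(* If two pairs with the same difference agree on one side, they agree on the
   other side; hence the one-sided rarity follows from that of single words. *)
have same a b a' : d a' b = d a b -> a' = a.
  rewrite /d => /code_cross cross; apply/ffunP => i; apply: val_inj.
  by have /= := cross i; lia.
have same' a b b' : d a b' = d a b -> b' = b.
  by rewrite /d => ?; apply: (same b a); rewrite /d; lia.
have rare_eq (a : word n) (P : pred (word n)) :
    alpha * n%:R <= \sum_i l (a i) -> (forall a', P a' -> a' = a) ->
    mean (iid p) (fun a' => (P a')%:R) <= rho n.
  move=> heavy Pa; apply: le_trans (word_rare heavy).
  rewrite -[leRHS]mulr1 -(mean_dirac (iid p) (fun=> 1)).
  apply: le_mean => // a'; rewrite mulr1 ler_nat.
  by case: (boolP (P a')) => // /Pa ->; rewrite eqxx.
have [u [v [Y [typY injY leY]]]] := sampling diid (expR_ge0 _) m_rho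
  (fun a b typ => let: And5 _ _ _ _ spread := typicalP typ in diff_rare spread)
  (fun a b typ => let: And5 _ _ heavy _ _ := typicalP typ in
     rare_eq a _ heavy (fun a' => fun e => same a b a' (eqP e)))
  (fun a b typ => let: And5 _ _ _ heavy _ := typicalP typ in
     rare_eq b _ heavy (fun b' => fun e => same' a b b' (eqP e))).
pose s := [seq (code w)%:Z | w <- codom u ++ codom v & light kappa w].
have lightA w : w \in codom u ++ codom v -> light kappa w ->
    (code w)%:Z \in [fset x in s]%fset.
  by move=> ws lw; rewrite in_fset_; apply: map_f; rewrite mem_filter lw.
exists [fset x in s]%fset; split.
- apply: (leq_trans (@card_fset_le s _ _)) => [x|]; first by rewrite in_fset_.
  rewrite size_map size_filter (leq_trans (count_size _ _)) //.
  by rewrite size_cat !size_codom card_ord mul2n addnn.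
- suff le_Y : (#|Y| <= #|` diffset [fset x in s]%fset|)%N.
    rewrite -(ler_nat R) natrX natrM.
    move: leY half le_Y; rewrite -(ler_nat R); set h := mean _ _ => leY half le_Y.
    have : m%:R ^+ 2 * (1 / 2) <= m%:R ^+ 2 * h by rewrite ler_wpM2l ?sqr_ge0.
    lra.
  rewrite cardE -(size_map (fun ij => d (u ij.1) (v ij.2))).
  apply: uniq_leq_size.
    rewrite map_inj_in_uniq ?enum_uniq // => i j.
    by rewrite !mem_enum; apply: injY.
  move=> x /mapP[ij]; rewrite mem_enum => /typY/typicalP[lu lv _ _ _] ->.
  apply/imfset2P; exists (code (u ij.1))%:Z.
    by apply: lightA => //; rewrite mem_cat codom_f.
  exists (code (v ij.2))%:Z => //.
  by apply: lightA => //; rewrite mem_cat codom_f orbT.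
- apply: (sumset_light (c := kappa) tau_ge0 sum_le) => x.
  rewrite in_fset_ => /mapP[w]; rewrite mem_filter => /andP[lw _] ->.
  by exists w.
Qed.

End Ruzsa.

(** * From exponential growth to exponents *)

(** Up to constant factors [|A|] is [expR (alpha * n)]: the lower bound follows
    from the size of the difference set, which is at most [|A| ^ 2].  For large
    [n] the constant factors are absorbed by [|A| `^ eps]. *)
Lemma exponents_of_growth {R : realType} (alpha sigma c : R) :
  0 < alpha -> 0 <= c -> sigma <= c * alpha ->
  (exists n0, forall n, (n0 <= n)%N -> exists A : {fset int}, [/\
    (#|` A| <= 2 * Num.truncn (expR (alpha * n%:R) / 8))%N,
    (Num.truncn (expR (alpha * n%:R) / 8) ^ 2 <= 4 * #|` diffset A|)%N
    & #|` sumset A|%:R <= expR (sigma * n%:R)]) ->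
  forall eps : R, 0 < eps -> exists A : {fset int},
    [/\ (1 < #|` A|)%N,
        #|` A|%:R `^ (2 - eps) <= #|` diffset A|%:R :> R
      & #|` sumset A|%:R <= #|` A|%:R `^ (c + eps) :> R].
Proof.
move=> alpha_gt0 c_ge0 sigma_le [n0 fam] eps eps_gt0.
pose bound : R := (ln 32 + 1 + (ln 16 + c * ln 32) / eps) / alpha.
pose n := maxn n0 (Num.truncn bound).+1.
have [A [leA leD leS]] := fam n (leq_maxl _ _).
exists A; set m := Num.truncn _ in leA leD.
(* 32 = 8 * 2 * 2: the factor 1/8 in the sample size, the rounding to an
   integer, and the factor 2 between m and |A|. *)
pose y : R := alpha * n%:R - ln 32.
have ln16 : 0 < ln 16 :> R by apply: ln_gt0; lra.
have ln32 : 0 < ln 32 :> R by apply: ln_gt0; lra.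
have y_ge : 1 + (ln 16 + c * ln 32) / eps <= y.
  have : bound <= n%:R.
    rewrite ltW // (lt_le_trans (truncnS_gt _)) // ler_nat; exact: leq_maxr.
  by rewrite /bound ler_pdivrMr // /y; lra.
have y_eps : ln 16 + c * ln 32 <= y * eps.
  by rewrite -ler_pdivrMr //; lra.
have y_gt0 : 0 < y.
  have : 0 <= (ln 16 + c * ln 32) / eps.
    by rewrite divr_ge0 ?ltW // ltr_wpDr // mulr_ge0 // ltW.
  lra.
have expE : expR (alpha * n%:R) = 32 * expR y.
  by rewrite /y expRB lnK ?posrE; [field|lra].
have leN : expR y <= #|` A|%:R.
  have y1 : 1 < expR y by rewrite expR_gt1.
  have : expR (alpha * n%:R) / 8 < m.+1%:R by apply: truncnS_gt.
  rewrite expE -natr1 => lt_m.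
  have : (m%:R : R) <= 2 * #|` A|%:R.
    rewrite -(@ler_pXn2r _ 2) ?nnegrE ?mulr_ge0 ?ler0n // exprMn -!natrX -natrM ler_nat.
    by apply: leq_trans leD _; rewrite leq_mul2l card_diffset.
  lra.
have N_gt1 : 1 < #|` A|%:R :> R by apply: lt_le_trans leN; rewrite expR_gt1.
have N_ge0 : 0 <= #|` A|%:R :> R by rewrite ler0n.
have N_pow e : 0 <= e -> expR (y * e) <= #|` A|%:R `^ e.
  by move=> e_ge0; rewrite expRM ge0_ler_powR // nnegrE ?expR_ge0.
split; first by rewrite -(ltr_nat R).
- rewrite powRB; last by rewrite (gt_eqF (lt_trans ltr01 N_gt1)) implybT.
  rewrite -[2]/(2%:R) powR_mulrn // ler_pdivrMr; last by rewrite powR_gt0; lra.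
  apply: (@le_trans _ _ (#|` diffset A|%:R * 16)).
    rewrite -natrX -natrM ler_nat.
    have : (#|` A| ^ 2 <= (2 * m) ^ 2)%N by rewrite leq_sqr.
    move=> /leq_trans; apply; rewrite expnMn mulnC -[16%N]/(4 * 4)%N mulnA.
    by rewrite leq_mul2r mulnC.
  rewrite ler_wpM2l // (le_trans _ (N_pow eps (ltW eps_gt0))) //.
  rewrite -[leLHS]lnK ?posrE // ler_expR (le_trans _ y_eps) // lerDl mulr_ge0 // ltW //.
- apply: (le_trans leS); apply: (le_trans _ (N_pow _ _)); last by rewrite addr_ge0 // ltW.
  rewrite ler_expR; apply: (@le_trans _ _ (c * alpha * n%:R)).
    by rewrite ler_wpM2r.
  have -> : c * alpha * n%:R = c * (y + ln 32) by rewrite /y; ring.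
  lra.
Qed.

(** * A law on four letters *)

Section Letters.
Context {R : realType}.

Definition weight (x : 'I_4) : R := nth 0 [:: 1674; 108; 9; 1] x / 1792.

(** The probability of each of the two differences [d] and [- d] of independent
    letters; the numerators are the autocorrelations of 1674, 108, 9, 1. *)
Definition diff_prob (d : nat) : R :=
  nth 0 [:: 1674 ^+ 2 + 108 ^+ 2 + 9 ^+ 2 + 1; 1674 * 108 + 108 * 9 + 9;
            1674 * 9 + 108; 1674] d / 1792 ^+ 2.

(** Information contents in units of 1/21 bit, rounded down.  In this unit
    the contents of the differences of absolute value at most 1, which dominate
    the entropy, exceed integers by less than 1/500. *)
Definition word_bits (x : 'I_4) : R := nth 0 [:: 2; 85; 160; 226] x.
Definition diff_bits (d : nat) : R := nth 0 [:: 4; 87; 162; 229] d.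

(** Turns an estimate of the logarithm of [P] into a comparison of powers. *)
Lemma le_expR_bits (q : nat) (P b : R) : 0 <= P -> (0 < q)%N ->
  P ^+ q * expR (ln 2 * b) <= 1 -> P <= expR (- (ln 2 * b / q%:R)).
Proof.
move=> P0 q0 le1; rewrite -(@ler_pXn2r _ q) ?nnegrE ?expR_ge0 // -expRM_natl.
rewrite mulrN mulrCA divff ?pnatr_eq0 -?lt0n // mulr1.
by rewrite expRN -[leRHS]mul1r ler_pdivlMr ?expR_gt0.
Qed.

Lemma expR_ln2 n : expR (ln 2 * n%:R) = 2 ^+ n :> R.
Proof. by rewrite expRM_natr lnK // posrE. Qed.

Lemma weight_dist : is_dist weight.
Proof.
split=> [x|]; last by rewrite !big_ord_recl big_ord0 /weight /=; lra.
by case: x => [[|[|[|[|//]]]] ?]; rewrite /weight /=; lra.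
Qed.

Lemma weight_le x : weight x <= expR (- (ln 2 * word_bits x / 21)).
Proof.
apply: le_expR_bits => //; first exact: weight_dist.1.
by case: x => [[|[|[|[|//]]]] ?]; rewrite /weight /word_bits /= expR_ln2; lra.
Qed.

Lemma diff_probE (x y : 'I_4) :
  mean weight (fun x' : 'I_4 => mean weight
    (fun y' : 'I_4 => (x' + y == x + y')%N%:R)) = diff_prob `|x - y|%N.
Proof.
rewrite /mean !big_ord_recl !big_ord0 /weight /diff_prob.
by case: x => [[|[|[|[|//]]]] ?]; case: y => [[|[|[|[|//]]]] ?]; rewrite /= ; field.
Qed.

Lemma diff_prob_le (d : nat) : (d < 4)%N ->
  diff_prob d <= expR (- (ln 2 * diff_bits d / 21)).
Proof.
by move=> d4; apply: le_expR_bits => //;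
  case: d d4 => [|[|[|[|//]]]] _; rewrite /diff_prob /diff_bits /= ?expR_ln2; lra.
Qed.

(** With z = 1/8 the powers of z sum to less than 8/7, and
    [(8 / 7) ^ 109 <= 2 ^ 21] gives the exponent
    [6 * 157 / 2180 + 21 / 109 = 1362 / 2180]. *)
Lemma geometric_sum_le :
  \sum_(j < 7) expR (3 * ln 2 * (2 * (157 / 2180) - j%:R))
  <= expR (ln 2 * (1362 / 2180)) :> R.
Proof.
have seven : 8 / 7 <= expR (- (ln 2 * - 21 / 109%:R)) :> R.
  by apply: le_expR_bits; rewrite // ?mulrN ?expRN ?expR_ln2; lra.
set A : R := expR (ln 2 * (942 / 2180)).
have -> : \sum_(j < 7) expR (3 * ln 2 * (2 * (157 / 2180) - j%:R))
    = A * \sum_(j < 7) (2 ^+ (3 * j))^-1.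
  rewrite mulr_sumr; apply: eq_bigr => j _.
  rewrite -expR_ln2 -expRN -expRD natrM; congr expR; lra.
apply: (@le_trans _ _ (A * (8 / 7))).
  rewrite ler_wpM2l ?expR_ge0 // !big_ord_recl big_ord0 /=.
  by rewrite /bump /= ?muln0 ?expr0; lra.
apply: le_trans (ler_wpM2l (expR_ge0 _) seven) _.
by rewrite -expRD ler_expR; lra.
Qed.

End Letters.

Lemma ratr_exponent (R : realType) : ratr 1.7354%Q = 8677 / 5000 :> R.
Proof.
rewrite /ratr.
have -> : numq 1.7354%Q = Posz 8677 by vm_compute.
have -> : denq 1.7354%Q = Posz 5000 by vm_compute.
by rewrite -!pmulrn.
Qed.

Unset Implicit Arguments.

Theorem corollary7 (R : realType) (eps : R) (eps_gt0 : 0 < eps) :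
  exists A : {fset int},
    [/\ (1 < #|` A|)%N,
        #|` A|%:R `^ (2 - eps) <= #|` diffset A|%:R :> R
      & #|` sumset A|%:R <= #|` A|%:R `^ (ratr 1.7354%Q + eps) :> R].
Proof.
have ln2 : 0 < ln 2 :> R by apply: ln_gt0; lra.
rewrite ratr_exponent.
(* 785 / 2180 is just below half the entropy of the difference, in bits, and
   1362 / 785 is just below 1.7354. *)
apply: (@exponents_of_growth R (ln 2 * (785 / 2180)) (ln 2 * (1362 / 2180))) => //.
- by rewrite mulr_gt0 //; lra.
- lra.
- lra.
(* 157 / 2180 is just above the mean letter 129 / 1792. *)
apply: (@ruzsa_set R 3 weight weight_dist (157 / 2180) _ _ (3 * ln 2)
  (fun x => ln 2 * word_bits x / 21)
  (fun x y => ln 2 * diff_bits `|x - y|%N / 21)).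
- by rewrite /mean !big_ord_recl big_ord0 /weight /= /bump !leq0n !add1n; lra.
- by rewrite /mean !big_ord_recl big_ord0 /weight /word_bits /=; lra.
- by rewrite /mean !big_ord_recl !big_ord0 /weight /diff_bits /=; lra.
- exact: weight_le.
- move=> x y; rewrite diff_probE; apply: diff_prob_le.
  by have := ltn_ord x; have := ltn_ord y; lia.
- lra.
- exact: geometric_sum_le.
Qed.
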